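(* Let $\mathbb{N}$ be the set of positive integers with the discrete topology and let $\beta(\mathbb{N})$ be its Stone–Čech compactification. Suppose $T$ is an additive local multiplication on $C(\beta(\mathbb{N}))$. Then there is a finite subset $D$ of $\mathbb{N}$ (depending on $T$) such that for every $f\in C_R(\beta(\mathbb{N}))$, $T(f)=T(1)\cdot f$ on $\beta(\mathbb{N})\setminus D$.
   Context: For a compact Hausdorff space $X$, $C(X)$ denotes the algebra of complex-valued continuous functions on $X$, and $C_R(X)$ the real-valued ones. A map $T$ on $C(X)$ is additive if $T(f+g)=T(f)+T(g)$ for all $f,g\in C(X)$; it is a local multiplication if for each $f\in C(X)$ there is $a_f\in C(X)$ with $T(f)=a_f f$. *)

(* Defs.v *)
From HB Require Import structures.
From mathcomp Require Import all_boot all_order all_algebra.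
From mathcomp Require Import all_classical all_reals all_analysis.
From mathcomp Require Export complex.

Set Implicit Arguments.
Unset Strict Implicit.
Unset Printing Implicit Defensive.

Import Order.TTheory GRing.Theory Num.Theory.
Import numFieldNormedType.Exports.

Local Open Scope classical_set_scope.
Local Open Scope ring_scope.

Section continuous_ring.
Context {X : topologicalType} {K : numFieldType}.
Implicit Types f g h : continuousType X K.

Local Lemma ctsN_subproof f : continuous (\- f).
Proof. by move=> x; apply: cvgN; exact: cts_fun. Qed.

Local Lemma ctsD_subproof f g : continuous (f \+ g).
Proof. by move=> x; apply: cvgD; exact: cts_fun. Qed.

Local Lemma ctsM_subproof f g : continuous (f \* g).
Proof. by move=> x; apply: cvgM; exact: cts_fun. Qed.

Definition cts0 : continuousType X K := cst 0.
Definition cts1 : continuousType X K := cst 1.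
Definition ctsN f : continuousType X K := mkcts (@ctsN_subproof f).
Definition ctsD f g : continuousType X K := mkcts (@ctsD_subproof f g).
Definition ctsM f g : continuousType X K := mkcts (@ctsM_subproof f g).

Local Lemma ctsDA : associative ctsD.
Proof. by move=> f g h; apply/continuousEP => x; exact: addrA. Qed.

Local Lemma ctsDC : commutative ctsD.
Proof. by move=> f g; apply/continuousEP => x; exact: addrC. Qed.

Local Lemma cts0D : left_id cts0 ctsD.
Proof. by move=> f; apply/continuousEP => x; exact: add0r. Qed.

Local Lemma ctsND : left_inverse cts0 ctsN ctsD.
Proof. by move=> f; apply/continuousEP => x; exact: addNr. Qed.

HB.instance Definition _ :=
  GRing.isZmodule.Build (continuousType X K) ctsDA ctsDC cts0D ctsND.

Local Lemma ctsMA : associative ctsM.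
Proof. by move=> f g h; apply/continuousEP => x; exact: mulrA. Qed.

Local Lemma ctsMC : commutative ctsM.
Proof. by move=> f g; apply/continuousEP => x; exact: mulrC. Qed.

Local Lemma cts1M : left_id cts1 ctsM.
Proof. by move=> f; apply/continuousEP => x; exact: mul1r. Qed.

Local Lemma ctsMD : left_distributive ctsM +%R.
Proof. by move=> f g h; apply/continuousEP => x; exact: mulrDl. Qed.

HB.instance Definition _ :=
  GRing.Zmodule_isComPzRing.Build (continuousType X K) ctsMA ctsMC cts1M ctsMD.

Lemma ctsDE f g x : (f + g) x = f x + g x. Proof. by []. Qed.
Lemma ctsME f g x : (f * g) x = f x * g x. Proof. by []. Qed.
Lemma cts1E x : (1 : continuousType X K) x = 1. Proof. by []. Qed.

End continuous_ring.

(** The topology on [complex R] is the one of its modulus, found through the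
    [numFieldType] structure, hence the cast. *)
Notation CX R X := (continuousType X (complex R : numFieldType)).

(** [Num.real] is the set of complex numbers with zero imaginary part *)
Definition real_valued (R : realType) (X : topologicalType) (f : CX R X) :=
  forall x, f x \is Num.real.

Definition additive_map (R : realType) (X : topologicalType)
  (T : CX R X -> CX R X) := forall f g, T (f + g) = T f + T g.

Definition local_multiplication (R : realType) (X : topologicalType)
  (T : CX R X -> CX R X) := forall f, exists a : CX R X, T f = a * f.

(** [B] with the map [i] is the Stone-Cech compactification of [X], in the
    sense of its universal property, which determines [(B, i)] up to a unique
    homeomorphism. *)
Definition is_stone_cech (X B : topologicalType) (i : X -> B) : Prop :=
  [/\ compact [set: B], hausdorff_space B, continuous i &
      forall (K : topologicalType) (g : X -> K),
        compact [set: K] -> hausdorff_space K -> continuous g ->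
        exists! h : continuousType B K, forall x, h (i x) = g x].

(** Existence for discrete [X]: the space of ultrafilters on [X], topologized
    by the base of sets [{F | A \in F}]. *)
Section ultrafilter_space.
Context {X : discreteTopologicalType}.

Definition ultrafilters : Type := {F : set_system X | UltraFilter F}.

HB.instance Definition _ := gen_eqMixin ultrafilters.
HB.instance Definition _ := gen_choiceMixin ultrafilters.

Implicit Types (F G : ultrafilters) (A B : set X).

Let uF F : UltraFilter (sval F) := svalP F.
Let pF F : ProperFilter (sval F) := ultra_proper (UltraFilter := uF F).
Local Existing Instance pF.

Definition ultra_base A : set ultrafilters := [set F | sval F A].

Local Lemma ultra_base_cover : \bigcup_(A in setT) ultra_base A = setT.
Proof. by apply/seteqP; split=> // F _; exists setT => //; exact: filterT. Qed.

Local Lemma ultra_base_join A B F : setT A -> setT B ->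
  ultra_base A F -> ultra_base B F ->
  exists C, [/\ setT C, ultra_base C F &
    ultra_base C `<=` ultra_base A `&` ultra_base B].
Proof.
move=> _ _ FA FB; exists (A `&` B); split=> //; first exact: filterI.
by move=> G GAB; split; apply: filterS GAB => x [].
Qed.

HB.instance Definition _ := isBaseTopological.Build ultrafilters
  ultra_base_cover ultra_base_join.

Definition ultra_pure (x : X) : ultrafilters :=
  exist _ _ (principal_filter_ultra x).

Lemma ultra_nbhsP F (U : set ultrafilters) :
  nbhs F U <-> exists2 A, sval F A & ultra_base A `<=` U.
Proof.
rewrite nbhsE /=; split=> [[V [[D _ <-] [A DA FA]] VU]|[A FA AU]].
  by exists A => // G GA; apply: VU; exists A.
exists (ultra_base A) => //; split=> //; exists [set A] => //.
by rewrite bigcup_set1.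
Qed.

Let mem_pure x A : sval (ultra_pure x) A <-> A x.
Proof. exact: principal_filterP. Qed.

Let base_disjoint F A B : sval F A -> sval F B -> A `&` B !=set0.
Proof. by move=> FA FB; apply: (@filter_ex _ (sval F)); exact: filterI. Qed.

Let ultrafilters_hausdorff : hausdorff_space ultrafilters.
Proof.
move=> F G FG; suff: sval F = sval G.
  by case: F G {FG} => [F uF'] [G uG'] /= FG; exact: eq_exist.
apply/esym/(@max_filter _ _ (uF F)) => A FA.
have [//|GnA] := in_ultra_setVsetC A (uF G).
have [H [HA HnA]] := FG (ultra_base A) (ultra_base (~` A))
  ((ultra_nbhsP _ _).2 (ex_intro2 _ _ _ FA (fun _ => id)))
  ((ultra_nbhsP _ _).2 (ex_intro2 _ _ _ GnA (fun _ => id))).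
by have [x []] := base_disjoint HA HnA.
Qed.

Let ultrafilters_compact : compact [set: ultrafilters].
Proof.
rewrite compact_ultra => U UU _.
have pU := ultra_proper (UltraFilter := UU).
pose L := [set A : set X | U (ultra_base A)].
have pL : ProperFilter L.
  apply: Build_ProperFilter_ex.
    move=> A LA; have [F FA] := @filter_ex _ U _ _ LA.
    exact: (@filter_ex _ (sval F) _ A).
  split.
  - apply: (@filterS _ U _ setT) filterT => F _; exact: filterT.
  - move=> A B LA LB; apply: (@filterS _ U) (@filterI _ U _ _ _ LA LB) => F [FA FB].
    exact: filterI.
  - by move=> A B AB; apply: (@filterS _ U) => F; exact: filterS.
have uL : UltraFilter L.
  split=> // G pG LG; apply/seteqP; split=> // A GA.
  have [//|] := in_ultra_setVsetC (ultra_base A) UU.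
  move=> UnA; have /LG GnA : L (~` A).
    apply: (@filterS _ U) UnA => F nFA; by have [|] := in_ultra_setVsetC A (uF F).
  by have /filter_ex[x []] : G (A `&` ~` A) by exact: filterI.
exists (exist _ L uL); split=> // V /ultra_nbhsP[A LA AV].
exact: (@filterS _ U) LA.
Qed.

Let ultra_lim (K : topologicalType) (g : X -> K) F :
  compact [set: K] -> exists k : K, cvg_to (fmap g (sval F)) (nbhs k).
Proof.
move=> /(_ (fmap g (sval F)) _ filterT)[k [_ gFk]]; exists k => V kV.
have [//|FnV] := in_ultra_setVsetC (g @^-1` V) (uF F).
by have [y []] := gFk (~` V) V FnV kV.
Qed.

Theorem ultrafilters_stone_cech : is_stone_cech ultra_pure.
Proof.
split=> //.
  move=> x U /ultra_nbhsP[A /mem_pure Ax AU].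
  apply: (filterS _ (discrete_set1 x)) => _ -> /=.
  exact/AU/mem_pure.
move=> K g cK hK _.
pose h F := projT1 (cid (ultra_lim g F cK)).
have hP F : cvg_to (fmap g (sval F)) (nbhs (h F)).
  by rewrite /h; case: cid.
have h_unique F (k : K) : cvg_to (fmap g (sval F)) (nbhs k) -> h F = k.
  by move=> gFk; exact: (cvg_unique hK (hP F) gFk).
have h_cts : continuous h.
  move=> F V hFV.
  have [W hFW WV] := compact_regular hK cK filterT hFV.
  apply/ultra_nbhsP; exists (g @^-1` W); first exact: hP hFW.
  move=> G GW; apply: WV => N hGN.
  have [x [Wx Nx]] := base_disjoint GW (hP G N hGN).
  by exists (g x).
exists (mkcts h_cts); split=> [x|h' h'g].
  by apply: h_unique => V gxV; apply/mem_pure; exact: nbhs_singleton gxV.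
apply/continuousEP => F; apply: h_unique => V h'FV.
have /ultra_nbhsP[A FA AV] := @cts_fun _ _ h' F V h'FV.
apply: filterS FA => x /mem_pure xA.
by rewrite /preimage /= -h'g; exact: AV.
Qed.

End ultrafilter_space.

Definition posnat : discreteTopologicalType :=
  discrete_topology {n : nat | (0 < n)%N}.

(* Main.v *)
Require Import Defs.
From HB Require Import structures.
From mathcomp Require Import all_boot all_order all_algebra.
From mathcomp Require Import all_classical all_reals all_analysis ring.
Import Order.TTheory GRing.Theory Num.Theory.
Import numFieldNormedType.Exports.
Local Open Scope classical_set_scope.
Local Open Scope ring_scope.

Set Implicit Arguments.
Unset Strict Implicit.

(** Since [T] is additive and [T f = a * f], the number [T f x] depends only
    on the value [f x]: if [f] and [g] agree at [x], then [f - g] vanishes at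
    [x] and so does [T (f - g)].  Hence [T] acts at each point [x] through the
    additive map [r |-> T (real_cst r) x] on the reals, and the theorem asks for
    which [x] this map is real-linear.  The function [defect T x] is its
    deviation from the linear map with the same value at [1].

    An additive map that is bounded on the unit interval and vanishes at [1]
    is zero ([additive_bounded_eq0]), so at a point with a nonzero defect
    the values [T (real_cst s) x], for [s] in the unit interval, are
    unbounded ([defect_unbounded]). If this happened at infinitely many
    integers [n], one could choose for each of them some [s n] in the unit
    interval with [|T (real_cst (s n)) n| > n]. The bounded sequence [s]
    extends to a continuous function on the compactification, whose image
    under [T] would be unbounded on a compact space. So the set [D] of
    integers with a nonzero defect is finite ([finite_nonlinear]).

    For a fixed real-valued [f], the equality [T f = T 1 * f] thus holds at
    the integers outside [D].  The set where it holds is closed, and so is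
    the finite set [D]; their union contains the dense set of integers
    ([stone_cech_dense]), hence is the whole space. *)

(** * Consequences of the universal property *)

Lemma compact_subtype (Y : topologicalType) (A : set Y) :
  compact A -> compact [set: A].
Proof.
move=> cA F PF _.
have [|y [Ay Fy]] := cA (fmap set_val F) _.
  by apply: (@filterS _ F _ setT) filterT => y _; exact: (set_valP y).
exists (SigSub (mem_set Ay) : A); split=> // S V FS [_ /= [[W oW <-] Wy] WV].
have FS' : fmap set_val F (set_val @` S).
  by apply: (@filterS _ F _ S) FS => z; exists z.
have [_ [[z Sz <-] Wz]] := Fy _ W FS' (open_nbhs_nbhs (conj oW Wy)).
by exists z; split=> //; exact: WV.
Qed.

Lemma hausdorff_subtype (Y : topologicalType) (A : set Y) :
  hausdorff_space Y -> hausdorff_space A.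
Proof.
move=> hY a b ab; apply/val_inj/hY => U V aU bV.
have sv := @initial_continuous A Y set_val.
have [c [Uc Vc]] := ab _ _ (sv a U aU) (sv b V bV).
by exists (set_val c).
Qed.

(** The universal property speaks of maps into compact Hausdorff spaces; maps
    into a compact part of a Hausdorff space are what is used below, and the
    subspace topology reduces the latter to the former. *)
Lemma stone_cech_extension (X B Y : topologicalType) (i : X -> B)
    (A : set Y) (g : X -> Y) :
  is_stone_cech i -> hausdorff_space Y -> compact A -> continuous g ->
  (forall x, A (g x)) ->
  exists h : continuousType B Y, (forall b, A (h b)) /\ (forall x, h (i x) = g x).
Proof.
move=> [_ _ _ ext] hY cA cg gA.
pose gA' (x : X) : A := SigSub (mem_set (gA x)).
have cgA : continuous gA' by apply: continuous_comp_initial.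
have [h [hg _]] := ext A gA' (compact_subtype cA) (hausdorff_subtype hY) cgA.
have ch : continuous (set_val \o h : B -> Y).
  by move=> b; apply: continuous_comp; [exact: cts_fun | exact: initial_continuous].
exists (mkcts ch); split=> [b|x]; first exact: set_valP.
exact: (congr1 set_val (hg x)).
Qed.

(** Extending [i], viewed as a map into the compact set [A], gives a map from
    [B] to [A] that fixes the image of [i], so it is the identity of [B] by
    uniqueness of extensions. *)
Lemma stone_cech_dense (X B : topologicalType) (i : X -> B) (A : set B) :
  is_stone_cech i -> closed A -> (forall x, A (i x)) -> A = [set: B].
Proof.
move=> iB clA iA; have [cB hB ci ext] := iB.
have cA : compact A by exact: subclosed_compact clA cB _.
have [h [hA hi]] := stone_cech_extension iB hB cA ci iA.
have [k [_ uk]] := ext B i cB hB ci.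
have ch : continuous (idfun : B -> B) by move=> b; exact: cvg_id.
apply/seteqP; split=> // b _.
have -> : b = h b; last exact: hA.
have kid := uk (mkcts ch) (fun=> erefl).
by rewrite -(uk h hi) kid.
Qed.

(** * Additive maps on the reals *)

(** Additivity and [psi 1 = 0] make [psi] periodic with period 1, so that it
    is bounded everywhere; but [psi (r *+ n) = psi r *+ n] grows with [n] as
    soon as [psi r] is nonzero. *)
Lemma additive_bounded_eq0 (R : archiRealFieldType) (V : normedZmodType R)
    (psi : {additive R -> V}) (M : R) :
  psi 1 = 0 -> (forall r, 0 <= r <= 1 -> `|psi r| <= M) -> psi =1 \0.
Proof.
move=> psi1 psiM r; apply/eqP; rewrite -normr_le0 leNgt; apply/negP => pr0.
have psiMT s : `|psi s| <= M.
  (* The fractional part of [s] lies in the unit interval. *)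
  rewrite -(subrK (Num.floor s)%:~R s) raddfD (raddfMz psi _ 1) psi1 mul0rz addr0.
  apply: psiM.
  by rewrite subr_ge0 floor_le/= lerBlDl -intrD1 ltW// floorD1_gt.
have M0 : 0 <= M by exact: le_trans (psiMT 0).
have := archi_boundP (divr_ge0 M0 (ltW pr0)).
rewrite ltr_pdivrMr// ltNge mulr_natl -normrMn -raddfMn.
by rewrite psiMT.
Qed.

(** * The modulus of continuous complex functions *)

Section complex_topology.
Variable R : realType.

Lemma normc_continuous :
  continuous (@Normc.normc R : (complex R : numFieldType) -> R).
Proof.
move=> z U /nbhs_ballP[e /= e0 eU]; apply/nbhs_ballP.
exists e%:C%C => [|w] /=; first by rewrite ltcR.
rewrite ltcR => zw; apply: eU; rewrite -ball_normE /=.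
exact: le_lt_trans (@ler_dist_dist _ (Rcomplex R) z w) zw.
Qed.

Lemma real_complex_continuous :
  continuous (real_complex R : R -> (complex R : numFieldType)).
Proof.
move=> r U /nbhs_ballP[e /= e0 eU]; apply/nbhs_ballP.
have eE : e = (complex.Re e)%:C%C by rewrite (RRe_real (gtr0_real e0)).
exists (complex.Re e) => [|s]; first by rewrite /= -ltcR -eE.
rewrite -ball_normE /= => rs; apply: eU; rewrite -ball_normE /= -rmorphB /=.
by rewrite normc_def /= expr0n addr0 sqrtr_sqr eE ltcR.
Qed.

End complex_topology.

Lemma compact_normc_bounded (R : realType) (X : topologicalType)
    (f : CX R X) : compact [set: X] ->
  exists n : nat, forall x, Normc.normc (f x) <= n%:R.
Proof.
move=> cX.
have cn : continuous (@Normc.normc R \o f : X -> R).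
  by move=> x; apply: continuous_comp; [exact: cts_fun|exact: normc_continuous].
have /compact_bounded[M [_ MA]] := continuous_compact (continuous_subspaceT cn) cX.
exists (Num.truncn M).+1 => x.
apply: le_trans (ler_norm _) _; apply: MA; first exact: truncnS_gt.
by exists x.
Qed.

Lemma closed_equalizer (X : topologicalType) (K : numFieldType)
    (f g : continuousType X K) : closed [set x | f x = g x].
Proof.
have -> : [set x | f x = g x] = (f - g) @^-1` [set 0].
  apply/seteqP; split=> x /= fg; first by rewrite ctsDE fg; exact: subrr.
  by apply/eqP; rewrite -subr_eq0; apply/eqP.
apply: preimage_closed; first by move=> x _; exact: cts_fun.
exact/accessible_closed_set1/hausdorff_accessible/norm_hausdorff.
Qed.

(** * The action of a local multiplication at a point *)

Section local_multiplication.
Context {R : realType} {X : topologicalType} (T : CX R X -> CX R X).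
Hypotheses (hadd : additive_map T) (hloc : local_multiplication T).

Definition real_cst (r : R) : CX R X := cst r%:C%C.

(** Locality makes [T (f - g)] vanish wherever [f - g] does. *)
Lemma local_multiplication_eval (f g : CX R X) x : f x = g x -> T f x = T g x.
Proof.
move=> fg; rewrite -(subrK g f) hadd ctsDE.
have [a ->] := hloc (f - g).
rewrite ctsME.
have -> : (f - g) x = 0 by rewrite ctsDE fg; exact: subrr.
by rewrite mulr0 add0r.
Qed.

(** The failure at [x] of real-linearity, measured against the only linear
    candidate: an additive map on the reals is linear exactly when it agrees
    with the linear map that has the same value at [1]. *)
Definition defect (x : X) (r : R) : R[i]%C :=
  T (real_cst r) x - T 1 x * r%:C%C.

Lemma defect_is_additive x : zmod_morphism (defect x).
Proof.
move=> r s; rewrite /defect.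
have -> : T (real_cst r) x = T (real_cst (r - s)) x + T (real_cst s) x.
  rewrite -ctsDE -hadd; congr (T _ _); apply/continuousEP => y.
  by rewrite ctsDE /= -rmorphD /= subrK.
rewrite rmorphB mulrBr.
have shuffle (a b p q : R[i]%C) : a - (p - q) = a + b - p - (b - q) by ring.
exact: shuffle.
Qed.

Lemma defect1 x : defect x 1 = 0.
Proof.
by rewrite /defect rmorph1 mulr1 (@local_multiplication_eval _ 1) ?subrr.
Qed.

(** The linear part [T 1 x * s] is bounded for [s] in the unit interval, so a bound on
    [T (real_cst s) x] would bound the defect there and force it to be zero. *)
Lemma defect_unbounded x r (M : R) : defect x r != 0 ->
  exists2 s, 0 <= s <= 1 & M < Normc.normc (T (real_cst s) x).
Proof.
move=> dr0; apply: contrapT => noS; move/eqP: dr0; apply.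
pose d : {additive R -> Rcomplex R} :=
  HB.pack (defect x) (GRing.isZmodMorphism.Build _ _ _ (defect_is_additive x)).
(* [Rcomplex R] has the real-valued modulus [Normc.normc] as its norm. *)
apply: (@additive_bounded_eq0 _ _ d (M + Normc.normc (T 1 x)) (defect1 x)).
move=> s /[dup] s01 /andP[s0 s1].
apply: le_trans (@ler_normB _ (Rcomplex R) _ _) _.
apply: lerD.
  by rewrite leNgt; apply/negP => Ms; apply: noS; exists s.
rewrite [leLHS]Normc.normcM ler_piMr ?(@normr_ge0 _ (Rcomplex R))//.
by rewrite /= expr0n addr0 sqrtr_sqr ger0_norm.
Qed.

End local_multiplication.

(** * Local multiplications on the compactification of the integers *)

(** At the integers [n] with a nonzero defect, a sequence with values in the
    unit interval can be chosen so that its extension [f] satisfies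
    [|T f n| > n]; a bound on the continuous function [T f] is then a bound
    on these [n]. *)
Lemma finite_nonlinear (R : realType) (betaN : topologicalType)
    (i : posnat -> betaN) (T : CX R betaN -> CX R betaN) :
  is_stone_cech i -> additive_map T -> local_multiplication T ->
  finite_set [set n : posnat | exists r, defect T (i n) r != 0].
Proof.
move=> hbeta hadd hloc; have [cB _ _ _] := hbeta.
set D := [set n | _].
pose P (n : posnat) (s : R) :=
  0 <= s <= 1 /\ (D n -> (sval n)%:R < Normc.normc (T (real_cst s) (i n))).
have /choice[s sP] : forall n, exists s, P n s.
  move=> n; have [[r dr]|nD] := pselect (D n); last first.
    by exists 0; split=> //; rewrite lexx ler01.
  have [s s01 ns] := defect_unbounded hadd hloc (sval n)%:R dr.
  by exists s.
have cs : continuous (s : posnat -> R).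
  move=> n U /nbhs_singleton Usn.
  by apply: (filterS _ (discrete_set1 n)) => _ ->.
have s01 n : `[0, 1]%classic (s n) by rewrite /= in_itv; have [] := sP n.
have [h [_ hi]] := stone_cech_extension hbeta (@Rhausdorff R)
  (@segment_compact R 0 1) cs s01.
have ch : continuous (real_complex R \o h : betaN -> (complex R : numFieldType)).
  move=> b; apply: continuous_comp; first exact: cts_fun.
  exact: real_complex_continuous.
have [M TM] := compact_normc_bounded (T (mkcts ch)) cB.
apply: (@sub_finite_set _ _ (sval @^-1` `I_M)).
  move=> n Dn /=; rewrite -(ltr_nat R).
  apply: lt_le_trans ((sP n).2 Dn) _.
  rewrite (local_multiplication_eval hadd hloc (g := mkcts ch)) ?TM//.
  exact: (congr1 (real_complex R) (esym (hi n))).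
by apply: finite_preimage; [move=> m n _ _; exact: val_inj | exact: finite_II].
Qed.

Theorem proposition1 (R : realType) (betaN : topologicalType)
    (i : posnat -> betaN) (hbeta : is_stone_cech i)
    (T : CX R betaN -> CX R betaN)
    (hadd : additive_map T) (hloc : local_multiplication T) :
  exists2 D : set posnat, finite_set D &
    forall f : CX R betaN, real_valued f ->
      forall x : betaN, (~` (i @` D)) x -> T f x = T 1 x * f x.
Proof.
have [_ hB _ _] := hbeta.
pose D := [set n : posnat | exists r, defect T (i n) r != 0].
have finD : finite_set D by exact: finite_nonlinear.
exists D => // f fR x Dx.
have clD : closed (i @` D).
  apply: accessible_finite_set_closed.1; first exact: hausdorff_accessible.
  exact: finite_image.
pose E := [set y | T f y = T 1 y * f y].
have clE : closed E by exact: (@closed_equalizer _ _ (T f) (T 1 * f)).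
suff iDE n : (i @` D `|` E) (i n).
  have DE := stone_cech_dense hbeta (closedU clD clE) iDE.
  by have [] : (i @` D `|` E) x by rewrite DE.
have [Dn|nD] := pselect (D n); [by left; exists n | right].
have [r fr] : exists r, f (i n) = r%:C%C.
  by exists (complex.Re (f (i n))); rewrite RRe_real.
rewrite /E /= (local_multiplication_eval hadd hloc (g := real_cst r))// fr.
apply/eqP; rewrite -subr_eq0; apply: contrapT => /negP d0.
by apply: nD; exists r.
Qed.
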